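(* Let $n\ge0$ be an integer and $\mathcal P_n$ the space of complex polynomials of degree at most $n$. Let $Q'_n$ be the operator $f(x)\mapsto f(-x-n-1)$ on $\mathcal P_n$ (i.e. $E^{n+1}(1,-x)$) and $J_n$ the operator $x^p\mapsto x^{n-p}$. Then $$F_n\,Q'_n\,F_n^{-1}=(-1)^nJ_n .$$
   Context: $F_n$ is the linear operator on $\mathcal P_n$ with $F_n x^p=(1-x)^{2n+1}\sum_{m\ge0}m^p\binom{m+n}{n}x^m$, $p=0,\dots,n$ (a polynomial of degree $\le n$; $0^0=1$). It is invertible, with $F_n^{-1}x^p=\frac{n!}{(2n)!}(x)_p[x+n+1]_{n-p}$, where $(\varphi)_k=\varphi(\varphi-1)\cdots(\varphi-k+1)$ and $[\varphi]_k=\varphi(\varphi+1)\cdots(\varphi+k-1)$, both $=1$ for $k=0$. *)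

(* Defs.v *)
From HB Require Import structures.
From mathcomp Require Export all_boot all_order all_algebra qpoly reals.
From mathcomp.real_closed Require Export complex.

Set Implicit Arguments.
Unset Strict Implicit.
Unset Printing Implicit Defensive.

Import Order.TTheory GRing.Theory Num.Theory.
Local Open Scope ring_scope.

(* The space of polynomials of degree at most n is {poly_n.+1 K}: the index
   of {poly_m K} bounds the size, i.e. the degree plus one. *)

(* The endomorphism sending x^p to g p for p = 0, ..., n. *)
Definition monomial_ext (K : fieldType) (n : nat)
    (g : 'I_n.+1 -> {poly_n.+1 K}) : 'End({poly_n.+1 K}) :=
  linfun (fun f : {poly_n.+1 K} => \sum_(p < n.+1) f`_p *: g p).

Lemma monomial_ext_sum (K : fieldType) (n : nat)
    (g : 'I_n.+1 -> {poly_n.+1 K}) (f : {poly_n.+1 K}) :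
  monomial_ext g f = \sum_(p < n.+1) f`_p *: g p.
Proof.
pose h (f : {poly_n.+1 K}) := \sum_(p < n.+1) f`_p *: g p.
have h_lin : linear h.
  move=> a u v; rewrite /h scaler_sumr -big_split /=; apply: eq_bigr => p _.
  by rewrite coefD coefZ scalerDl scalerA.
pose hL := GRing.isLinear.Build K _ _ _ h h_lin.
pose H : {linear {poly_n.+1 K} -> {poly_n.+1 K}} := HB.pack h hL.
exact: (lfunE H).
Qed.

Lemma monomial_extE (K : fieldType) (n : nat)
    (g : 'I_n.+1 -> {poly_n.+1 K}) (p : 'I_n.+1) :
  monomial_ext g (npolyp n.+1 'X^p) = g p.
Proof.
have szX : (size ('X^p : {poly K}) <= n.+1)%N by rewrite size_polyXn.
rewrite monomial_ext_sum (bigD1 p) //= npolypK // coefXn eqxx scale1r.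
rewrite big1 ?addr0 // => q; rewrite -val_eqE /= => /negPf neq_qp.
by rewrite coefXn neq_qp scale0r.
Qed.

(* Formal power series are given by their coefficient sequences, and
   multiplied by the Cauchy product. *)
Definition fps_mul (K : fieldType) (a b : nat -> K) (k : nat) : K :=
  \sum_(j < k.+1) a j * b (k - j)%N.

(* (1 - x)^(2n+1) \sum_(m >= 0) m^p C(m+n, n) x^m, with 0^0 = 1. *)
Definition F_series (K : fieldType) (n p : nat) : nat -> K :=
  fps_mul (fun j => ((1 - 'X) ^+ (2 * n + 1))`_j)
          (fun m => m%:R ^+ p * 'C(m + n, n)%:R).

(* For p <= n the coefficients of F_series n p beyond x^n vanish, so this
   truncation is the whole series: see F_opE. *)
Definition F_op (K : fieldType) (n : nat) : 'End({poly_n.+1 K}) :=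
  monomial_ext (fun p : 'I_n.+1 => mk_npoly n.+1 (F_series K n p)).

(* The composite has the same degree as f, so npolyp truncates nothing:
   see Q'_opE. *)
Definition Q'_op (K : fieldType) (n : nat) : 'End({poly_n.+1 K}) :=
  linfun (fun f : {poly_n.+1 K} =>
            npolyp n.+1 ((f : {poly K}) \Po (- 'X - (n.+1)%:R%:P))).

Definition J_op (K : fieldType) (n : nat) : 'End({poly_n.+1 K}) :=
  monomial_ext (fun p : 'I_n.+1 => npolyp n.+1 'X^(n - p)).

Lemma Q'_opE (K : fieldType) (n : nat) (f : {poly_n.+1 K}) :
  Q'_op K n f = (f : {poly K}) \Po (- 'X - (n.+1)%:R%:P) :> {poly K}.
Proof.
pose s : {poly K} := - 'X - (n.+1)%:R%:P.
have sz_s : size s = 2%N.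
  by rewrite /s -opprD size_polyN size_XaddC.
have sz_comp (u : {poly_n.+1 K}) : (size ((u : {poly K}) \Po s) <= n.+1)%N.
  have := size_comp_poly2 u sz_s.
  by move=> ->; exact: size_npoly.
pose h (u : {poly_n.+1 K}) : {poly_n.+1 K} := npolyp n.+1 ((u : {poly K}) \Po s).
have h_lin : linear h.
  move=> a u v; apply: val_inj => /=.
  rewrite /h (npolypK (sz_comp (a *: u + v))).
  by rewrite (npolypK (sz_comp u)) (npolypK (sz_comp v)) comp_polyD comp_polyZ.
pose hL := GRing.isLinear.Build K _ _ _ h h_lin.
pose H : {linear {poly_n.+1 K} -> {poly_n.+1 K}} := HB.pack h hL.
have -> : Q'_op K n f = h f by exact: (lfunE H).
by rewrite /h npolypK.
Qed.

Lemma finite_difference_eq0 (K : fieldType) (N : nat) (g : {poly K}) (x : K) :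
  (size g <= N)%N ->
  \sum_(j < N.+1) ((1 - 'X) ^+ N)`_j * g.[x - j%:R] = 0.
Proof.
elim: N g x => [|N IHN] g x.
  rewrite size_poly_leq0 => /eqP ->.
  by rewrite big1 // => j _; rewrite horner0 mulr0.
move=> sz_g; pose d : {poly K} := g - (g \Po ('X - 1%:P)).
have sz_d : (size d <= N)%N.
  apply/leq_sizeP => i; rewrite leq_eqVlt => /orP[/eqP <-|ltNi]; last first.
    rewrite /d coefB !nth_default ?subr0 //.
      by rewrite size_comp_poly2 ?size_XsubC // (leq_trans sz_g).
    exact: leq_trans sz_g _.
  rewrite /d coefB; have [szN|szN] := leqP (size g) N.
    by rewrite !nth_default ?subr0 // size_comp_poly2 ?size_XsubC.
  have sgE : size g = N.+1 by apply/eqP; rewrite eqn_leq sz_g.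
  have : lead_coef (g \Po ('X - 1%:P)) = lead_coef g.
    rewrite lead_coef_comp ?size_XsubC //.
    by rewrite lead_coefXsubC expr1n mulr1.
  by rewrite /lead_coef size_comp_poly2 ?size_XsubC // sgE /= => ->; rewrite subrr.
rewrite -[RHS](IHN d x sz_d) [(1 - 'X) ^+ N.+1]exprSr mulrBr mulr1.
have cN1 : ((1 - 'X : {poly K}) ^+ N)`_N.+1 = 0.
  apply: nth_default; apply: leq_trans (size_poly_exp_leq _ _) _.
  by rewrite -(size_polyN (1 - 'X)) opprB size_XsubC mul1n.
under eq_bigr => j _ do rewrite coefB mulrBl.
rewrite sumrB [X in X - _]big_ord_recr /= cN1 mul0r addr0.
rewrite [X in _ - X]big_ord_recl coefMX /= mul0r add0r -sumrB.
apply: eq_bigr => j _; rewrite coefMX /= -mulrBr; congr (_ * _).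
rewrite hornerD hornerN horner_comp !hornerE.
by congr (_ - g.[_]); rewrite /bump /= natrD opprD addrA addrAC.
Qed.

Lemma F_series_eq0 (K : numFieldType) (n p k : nat) :
  (p <= n)%N -> (n < k)%N -> F_series K n p k = 0.
Proof.
move=> le_pn lt_nk; pose N := (2 * n + 1)%N.
pose g : {poly K} :=
  (n`!%:R)^-1 *: ('X^p * \prod_(i < n) ('X - (- (i.+1)%:R)%:P)).
pose c j := ((1 - 'X : {poly K}) ^+ N)`_j.
have fact_n0 m : (m`!%:R : K) != 0 by rewrite pnatr_eq0 -lt0n fact_gt0.
have gE (y : K) : g.[y] = (n`!%:R)^-1 * (y ^+ p * \prod_(i < n) (y + (i.+1)%:R)).
  rewrite /g hornerZ hornerM hornerXn horner_prod.
  by congr (_ * (_ * _)); apply: eq_bigr => i _; rewrite !hornerE ?opprK.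
have g_nat (m : nat) : g.[m%:R] = m%:R ^+ p * 'C(m + n, n)%:R.
  rewrite gE mulrCA; congr (_ * _).
  have -> : \prod_(i < n) (m%:R + (i.+1)%:R) = ('C(m + n, n) * n`!)%:R :> K.
    rewrite bin_ffact; elim: n {le_pn lt_nk N g c gE} => [|q IHq].
      by rewrite big_ord0 ffactn0.
    by rewrite big_ord_recr /= IHq addnS ffactSS mulnC natrM -addnS natrD.
  by rewrite natrM mulrCA mulVf ?mulr1.
have g_neg (i : nat) : (i < n)%N -> g.[- (i.+1)%:R] = 0.
  move=> lt_in; rewrite gE (bigD1 (Ordinal lt_in)) //= addNr mul0r.
  by rewrite !mulr0.
have sz_g : (size g <= N)%N.
  rewrite (leq_trans (size_scale_leq _ _)) // size_monicM ?monicXn //; last first.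
    by apply: monic_neq0; apply: monic_prod => i _; exact: monicXsubC.
  rewrite size_polyXn size_prod_XsubC ?/index_enum -?enumT size_enum_ord addSn /=.
  by rewrite addnS /N addn1 mul2n -addnn ltnS leq_add2r.
have c_big j : (N < j)%N -> c j = 0.
  move=> lt_Nj; apply: nth_default; apply: leq_trans (size_poly_exp_leq _ _) _.
  by rewrite -(size_polyN (1 - 'X)) opprB size_XsubC mul1n.
have := finite_difference_eq0 k%:R sz_g; rewrite -/N => <-.
pose G j := c j * g.[k%:R - j%:R].
transitivity (\sum_(j < k.+1) G j).
  apply: eq_bigr => j _; rewrite /G; congr (_ * _).
  by rewrite -natrB ?g_nat // -ltnS.
transitivity (\sum_(0 <= j < (k + N).+1) G j).
  rewrite (@big_cat_nat _ _ _ k.+1) //=; last by rewrite ltnS leq_addr.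
  rewrite big_mkord [X in _ + X]big1_seq ?addr0 // => j /andP[_].
  rewrite mem_index_iota => /andP[lt_kj _]; rewrite /G.
  have [lt_Nj|le_jN] := ltnP N j; first by rewrite c_big ?mul0r.
  have lt_jk : ((j - k).-1 < n)%N.
    rewrite prednK ?subn_gt0 // leq_subLR (leq_trans le_jN) // /N.
    by rewrite mul2n -addnn addn1 -addSn leq_add2r.
  rewrite -opprB -natrB 1?ltnW // -[(j - k)%N]prednK ?subn_gt0 //.
  by rewrite g_neg ?mulr0.
rewrite (@big_cat_nat _ _ _ N.+1) //=; last by rewrite ltnS leq_addl.
rewrite big_mkord [X in _ + X]big1_seq ?addr0 // => j /andP[_].
by rewrite mem_index_iota => /andP[lt_Nj _]; rewrite /G c_big ?mul0r.
Qed.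

Lemma F_opE (K : numFieldType) (n : nat) (p : 'I_n.+1) (k : nat) :
  (F_op K n (npolyp n.+1 'X^p) : {poly K})`_k = F_series K n p k.
Proof.
rewrite monomial_extE /= coef_poly; case: ltnP => // lt_nk.
by rewrite F_series_eq0 // -ltnS.
Qed.

(* (f^-1)%VF is in general only a one-sided inverse on the image of f; by
   injectivity (F_op K n)^-1 is the two-sided inverse of F_op K n. *)
Lemma F_op_inj (K : numFieldType) (n : nat) : lker (F_op K n) == 0%VS.
Proof.
apply/lker0P; apply: raddf_inj => f Ff0; apply: val_inj => /=.
pose c j := ((1 - 'X : {poly K}) ^+ (2 * n + 1))`_j.
pose b (m : nat) : K := (f : {poly K}).[m%:R] * 'C(m + n, n)%:R.
have Fb k : fps_mul c b k = 0.
  have : (F_op K n f : {poly K})`_k = 0 by rewrite Ff0 coef0.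
  rewrite monomial_ext_sum coefn_sum => <-.
  transitivity (\sum_(p < n.+1) (f : {poly K})`_p * F_series K n p k); last first.
    apply: eq_bigr => p _; rewrite -F_opE monomial_extE.
    exact/esym/coefZ.
  rewrite /F_series /fps_mul; under [RHS]eq_bigr => p _ do rewrite mulr_sumr.
  rewrite exchange_big; apply: eq_bigr => j _ /=.
  rewrite /b (horner_coef_wide _ (size_npoly f)) mulr_suml mulr_sumr.
  by apply: eq_bigr => p _; rewrite -/(c j) [RHS]mulrCA -!mulrA.
have c0 : c 0%N = 1.
  by rewrite /c -horner_coef0 !hornerE subr0 expr1n.
have b0 m : b m = 0.
  elim/ltn_ind: m => m IHm; have := Fb m.
  rewrite /fps_mul big_ord_recl c0 mul1r subn0 big1 ?addr0 // => j _.
  by rewrite IHm ?mulr0 //= /bump /= add1n ltn_subrL /= (leq_trans _ (ltn_ord j)).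
apply/eqP; apply: contraT => f_neq0.
pose rs : seq K := [seq m%:R | m <- iota 0 n.+1].
have rs_uniq : uniq rs.
  rewrite map_inj_uniq ?iota_uniq // => i j /eqP.
  by rewrite eqr_nat => /eqP.
have rs_root : all (root f) rs.
  apply/allP => _ /mapP[m _ ->].
  have bin_n0 : 'C(m + n, n)%:R != 0 :> K.
    by rewrite pnatr_eq0 -lt0n bin_gt0 leq_addl.
  by move/eqP: (b0 m); rewrite /b mulf_eq0 (negPf bin_n0) orbF.
have := max_poly_roots f_neq0 rs_root rs_uniq.
by rewrite size_map size_iota ltnNge size_npoly.
Qed.

(* Main.v *)
From mathcomp Require Import zify ring.
Require Import Defs.

Import GRing.Theory Num.Theory.

Set Implicit Arguments.
Unset Strict Implicit.
Unset Printing Implicit Defensive.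

Local Open Scope ring_scope.

(** For a polynomial f of degree at most n, F_n f is (1 - x)^(2n+1) times the
    generating series of g(m) = f(m) C(m+n, n), a polynomial in m of degree at
    most 2n. The symmetry C(-x-1, n) = (-1)^n C(x+n, n) shows that replacing f
    by f(-x-n-1) replaces g by (-1)^n g(-x-n-1). As the (2n+1)-st difference of
    g vanishes and g vanishes at -1, ..., -n, that difference breaks up into
    two sums, which are the coefficients of x^(n-k) in F_n f and of x^k in
    (-1)^n F_n (f(-x-n-1)). *)

(** The polynomial C(x+n, n) in x, which extends the binomial factor of [F_series] to negative
    points. *)
Definition bin_poly (K : fieldType) (n : nat) : {poly K} :=
  (n`!%:R)^-1 *: \prod_(i < n) ('X - (- (i.+1)%:R)%:P).

Lemma horner_bin_poly (K : fieldType) (n : nat) (x : K) :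
  (bin_poly K n).[x] = (n`!%:R)^-1 * \prod_(i < n) (x + (i.+1)%:R).
Proof.
rewrite hornerZ horner_prod; congr (_ * _).
by apply: eq_bigr => i _; rewrite hornerXsubC opprK.
Qed.

Lemma horner_bin_poly_nat (K : numFieldType) (n m : nat) :
  (bin_poly K n).[m%:R] = 'C(m + n, n)%:R.
Proof.
have fact_neq0 : (n`!%:R : K) != 0 by rewrite pnatr_eq0 -lt0n fact_gt0.
rewrite horner_bin_poly; apply: (mulfI fact_neq0).
rewrite mulVKf // mulrC -natrM bin_ffact.
elim: n {fact_neq0} => [|n IHn]; first by rewrite big_ord0 ffactn0.
by rewrite big_ord_recr /= IHn -natrD -natrM addnS ffactSS mulnC.
Qed.

Lemma horner_bin_poly_eq0 (K : fieldType) (n i : nat) :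
  (i < n)%N -> (bin_poly K n).[- (i.+1)%:R] = 0.
Proof.
move=> lt_in; rewrite horner_bin_poly (bigD1 (Ordinal lt_in)) //= addNr.
by rewrite mul0r mulr0.
Qed.

(** The substitution sends the factor x + i + 1 to -(x + n - i): it reverses the order of the n
    factors and changes the sign of each. *)
Lemma horner_bin_poly_refl (K : fieldType) (n : nat) (x : K) :
  (bin_poly K n).[- x - (n.+1)%:R] = (-1) ^+ n * (bin_poly K n).[x].
Proof.
rewrite !horner_bin_poly mulrCA; congr (_ * _).
have -> : (-1 : K) ^+ n = \prod_(i < n) -1 by rewrite prodr_const card_ord.
rewrite (reindex_inj rev_ord_inj) -big_split; apply: eq_bigr => i _ /=.
have lt_in := ltn_ord i; rewrite (_ : n.+1 = (n - i.+1).+1 + i.+1)%N; last lia.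
by rewrite natrD; ring.
Qed.

Lemma size_bin_poly (K : fieldType) (n : nat) : (size (bin_poly K n) <= n.+1)%N.
Proof.
rewrite (leq_trans (size_scale_leq _ _)) //.
by rewrite size_prod_XsubC /index_enum -enumT size_enum_ord.
Qed.

Lemma coef_1subX_exp (K : fieldType) (N j : nat) :
  ((1 - 'X : {poly K}) ^+ N)`_j = (-1) ^+ j * 'C(N, j)%:R.
Proof.
elim: N j => [|N IHN] [|j].
- by rewrite !expr0 coefC eqxx bin0 mulr1.
- by rewrite expr0 coefC bin0n mulr0.
- by rewrite exprSr mulrBr mulr1 coefB coefMX IHN !bin0 subr0.
- by rewrite exprSr mulrBr mulr1 coefB coefMX /= !IHN binS natrD exprS; ring.
Qed.

(** For odd N the indices j and N - j have opposite parity, while the binomial coefficients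
    agree. *)
Lemma coef_1subX_odd_refl (K : fieldType) (N j : nat) :
  odd N -> (j <= N)%N ->
  ((1 - 'X : {poly K}) ^+ N)`_(N - j) = - ((1 - 'X : {poly K}) ^+ N)`_j.
Proof.
move=> oddN le_jN; rewrite !coef_1subX_exp bin_sub // -mulNr; congr (_ * _).
rewrite -[LHS]signr_odd -[in RHS]signr_odd oddB // oddN.
by case: (odd j); rewrite /= ?expr0 ?expr1 ?opprK.
Qed.

(** The minus sign from moving the last block of the vanishing difference across the equation
    cancels the one in [coef_1subX_odd_refl]. *)
Lemma finite_difference_split (K : fieldType) (a k : nat) (g : {poly K}) :
  (size g <= 2 * (a + k) + 1)%N ->
  (forall i, (i < a + k)%N -> g.[- (i.+1)%:R] = 0) ->
  let c j := ((1 - 'X : {poly K}) ^+ (2 * (a + k) + 1))`_j in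
  \sum_(j < a.+1) c j * g.[a%:R - j%:R] =
  \sum_(j < k.+1) c j * g.[- (k%:R - j%:R) - ((a + k).+1)%:R].
Proof.
move=> sz_g g0 c; have := finite_difference_eq0 a%:R sz_g.
rewrite -(big_mkord xpredT (fun j => c j * g.[a%:R - j%:R])).
(* With n = a + k, the 2n + 2 points are a, ..., 0, then the zeros -1, ..., -n of g, then -n-1, ...,
   -n-k-1. *)
have -> : (2 * (a + k) + 1).+1 = (a.+1 + (a + k) + k.+1)%N by lia.
rewrite big_mkord big_split_ord big_split_ord /=.
rewrite [X in _ + X + _]big1 ?addr0 => [|i _]; last first.
  have -> : a%:R - (a.+1 + i)%:R = - (i.+1)%:R :> K.
    by rewrite addSnnS natrD; ring.
  by rewrite g0 ?mulr0.
move/eqP; rewrite addr_eq0 => /eqP ->; rewrite -sumrN.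
rewrite (reindex_inj rev_ord_inj); apply: eq_bigr => j _ /=.
have le_jk : (j <= k)%N by rewrite -ltnS.
have -> : (a.+1 + (a + k) + (k.+1 - j.+1) = 2 * (a + k) + 1 - j)%N by lia.
rewrite /c coef_1subX_odd_refl ?mulNr ?opprK; [| by rewrite oddD oddM | lia].
congr (_ * g.[_]); rewrite natrB; last lia.
by rewrite -addn1 mul2n -addnn !natrD; ring.
Qed.

(** Taking the points k - j in K rather than in [nat] makes the coefficient an initial segment of a
    finite difference. *)
Lemma coef_F_op (K : numFieldType) (n k : nat) (f : {poly_n.+1 K}) :
  (F_op K n f : {poly K})`_k =
  \sum_(j < k.+1) ((1 - 'X : {poly K}) ^+ (2 * n + 1))`_j *
    ((f : {poly K}) * bin_poly K n).[k%:R - j%:R].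
Proof.
rewrite monomial_ext_sum coefn_sum.
transitivity (\sum_(p < n.+1) (f : {poly K})`_p * F_series K n p k).
  apply: eq_bigr => p _; rewrite -F_opE monomial_extE.
  exact: coefZ.
rewrite /F_series /fps_mul; under eq_bigr => p _ do rewrite mulr_sumr.
rewrite exchange_big; apply: eq_bigr => j _ /=.
have le_jk : (j <= k)%N by rewrite -ltnS.
rewrite -natrB // hornerM horner_bin_poly_nat.
rewrite (horner_coef_wide _ (size_npoly f)) mulr_suml mulr_sumr.
by apply: eq_bigr => p _; rewrite mulrCA !mulrA.
Qed.

(** For k > n the truncated n - k would be 0 and pick out the constant coefficient of f. *)
Lemma coef_J_op (K : fieldType) (n k : nat) (f : {poly_n.+1 K}) :
  (k <= n)%N -> (J_op K n f : {poly K})`_k = (f : {poly K})`_(n - k).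
Proof.
move=> le_kn; rewrite monomial_ext_sum coefn_sum.
have lt_nk : (n - k < n.+1)%N by rewrite ltnS leq_subr.
have szX (p : nat) : (size ('X^(n - p) : {poly K}) <= n.+1)%N.
  by rewrite size_polyXn ltnS leq_subr.
rewrite (bigD1 (Ordinal lt_nk)) //= big1 => [|p neq_p].
  by rewrite addr0 coefZ npolypK // subKn // coefXn eqxx mulr1.
rewrite coefZ npolypK // coefXn; case: eqP => [k_eq|_]; last by rewrite mulr0.
by case/eqP: neq_p; apply: val_inj => /=; rewrite k_eq subKn // -ltnS.
Qed.

(** This intertwining form is free of inverses; composing on the right with the inverse of [F_op]
    gives the theorem. *)
Lemma F_op_Q'_op (K : numFieldType) (n : nat) :
  (F_op K n \o Q'_op K n)%VF = (-1) ^+ n *: (J_op K n \o F_op K n)%VF.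
Proof.
apply/lfunP => f; rewrite scale_lfunE !comp_lfunE.
apply/val_inj/polyP => k /=; rewrite coefZ.
have [lt_nk|le_kn] := ltnP n k.
  by rewrite !nth_default ?mulr0 // (leq_trans (size_npoly _)).
rewrite coef_J_op // !coef_F_op.
set g := (f : {poly K}) * bin_poly K n.
(* Here n is kept as n - k + k to match [finite_difference_split] with a = n - k. *)
have sz_g : (size g <= 2 * (n - k + k) + 1)%N.
  rewrite subnK // (leq_trans (size_polyMleq _ _)) //.
  rewrite -subn1 leq_subLR.
  by rewrite (leq_trans (leq_add (size_npoly f) (size_bin_poly K n))) //; lia.
have g0 i : (i < n - k + k)%N -> g.[- (i.+1)%:R] = 0.
  by rewrite subnK // => lt_in; rewrite hornerM horner_bin_poly_eq0 ?mulr0.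
have := finite_difference_split sz_g g0; rewrite subnK // => /= ->.
rewrite mulr_sumr; apply: eq_bigr => j _; rewrite mulrCA; congr (_ * _).
rewrite Q'_opE !hornerM horner_comp hornerD !hornerN hornerX hornerC.
(* The sign from reflecting [bin_poly] at k - j cancels the factor (-1)^n in front. *)
rewrite horner_bin_poly_refl.
by rewrite [in RHS]mulrCA signrMK.
Qed.

Theorem theorem11 (R : realType) (n : nat) :
  (F_op R[i] n \o Q'_op R[i] n \o (F_op R[i] n)^-1)%VF
  = (-1) ^+ n *: J_op R[i] n.
Proof.
rewrite F_op_Q'_op comp_lfunZl -comp_lfunA lker0_compfV ?F_op_inj //.
by rewrite comp_lfun1r.
Qed.
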